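(* When $A$ is infinite, coordinatewise pairwise compactness need not imply pairwise soft compactness, even for canonical soft bitopologies and even for compact Hausdorff coordinate groups. That is, for every infinite set $A$ there exist a group $G$, a soft group $F:A\to\mathcal P(G)$ and canonical soft topologies $\tau_1,\tau_2$ on $F$ such that for every $t\in A$ and $i\in\{1,2\}$ the group $(F(t),(\tau_i)_t)$ is a compact Hausdorff topological group and $F(t)$ is pairwise compact in $(F(t),(\tau_1)_t,(\tau_2)_t)$, but $(F,\tau_1,\tau_2)$ is not pairwise soft compact.
   Context: A soft set over $G$ with parameter set $A$ is a map $F:A\to\mathcal P(G)$; it is a soft group if every $F(t)$ is a subgroup of $G$. $\mathrm{SE}(F)=\prod_{t\in A}F(t)$. A soft subset of $F$ is a map $H:A\to\mathcal P(G)$ with $H(t)\subseteq F(t)$ for all $t$; soft unions and intersections are parameterwise. A soft topology $\tau$ on $F$ is a family of soft subsets of $F$ containing $F$ and the empty soft set (all sections empty), closed under arbitrary soft unions and finite soft intersections. Component topology: $\tau_t=\{H(t):H\in\tau\}$ on $F(t)$. $\tau$ is canonical if it consists of all soft subsets $H$ of $F$ with $H(t)\in\tau_t$ for all $t$. The selector (box) topology $\tau^\ast$ on $\mathrm{SE}(F)$ has base $\{\prod_{t\in A}U_t:U_t\in\tau_t\ \forall t\}$. For topologies $\alpha,\beta$ on a set, $\alpha\vee\beta$ is the topology generated by $\alpha\cup\beta$. A subset of a bitopological space $(Y,\alpha,\beta)$ is pairwise compact if it is compact as a subspace of $(Y,\alpha\vee\beta)$. $(F,\tau_1,\tau_2)$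 is pairwise soft compact if $\mathrm{SE}(F)$ is compact in $(\tau_1)^\ast\vee(\tau_2)^\ast$. *)

(* Defs.v *)
From HB Require Import structures.
From mathcomp Require Import all_boot monoid.
From mathcomp Require Import boolp classical_sets functions cardinality.
From mathcomp Require Import topology.

Set Implicit Arguments.
Unset Strict Implicit.
Unset Printing Implicit Defensive.

Local Open Scope classical_set_scope.

(* Soft sets have sections that are subsets of one ambient group, so a topology
   on a set K is kept as a family of subsets of the ambient type contained
   in K. *)
Record is_topology (T : Type) (K : set T) (tau : set (set T)) : Prop := {
  topo_sub : forall U, tau U -> U `<=` K;
  topo_full : tau K;
  topo_empty : tau set0;
  topo_bigcup : forall C : set (set T), C `<=` tau -> tau (\bigcup_(U in C) U);
  topo_setI : forall U V, tau U -> tau V -> tau (U `&` V)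
}.

Record topology (T : Type) (K : set T) := Topology {
  opens :> set (set T);
  opensP : is_topology K opens
}.

(* The points of K (as a type) with the topology tau. *)
Definition space (T : choiceType) (K : set T) (tau : topology K) : Type :=
  set_type K.

Section SpaceTopology.
Context (T : choiceType) (K : set T) (tau : topology K).

Definition space_open : set_system (space tau) :=
  [set U | opens tau [set val x | x in (U : set (set_type K))]].

Let space_openT : space_open setT.
Proof.
rewrite /space_open /=; have -> : [set val x | x in [set: set_type K]] = K.
  apply/seteqP; split=> [_ [x _ <-]|x Kx]; first exact/set_mem/(valP x).
  by exists (SigSub (mem_set Kx)).
exact: (topo_full (opensP tau)).
Qed.

Let space_openI : setI_closed space_open.
Proof.
move=> U V oU oV; rewrite /space_open /=.
rewrite (_ : [set _ | _ in _] =
  [set val x | x in (U : set (set_type K))] `&`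
  [set val x | x in (V : set (set_type K))]).
  exact: (topo_setI (opensP tau) oU oV).
apply/seteqP; split=> [_ [x [Ux Vx] <-]|_ [[x Ux <-] [y Vy /val_inj yx]]].
  by split; exists x.
by exists x => //; split => //; rewrite -yx.
Qed.

Let space_open_bigU (I : Type) (f : I -> set (space tau)) :
  (forall i, space_open (f i)) -> space_open (\bigcup_i f i).
Proof.
move=> of_; rewrite /space_open /=.
pose im i := [set val x | x in (f i : set (set_type K))].
rewrite (_ : [set _ | _ in _] = \bigcup_(U in range im) U).
  by apply: (topo_bigcup (opensP tau)) => _ [i _ <-]; exact: of_.
apply/seteqP; split=> [_ [x [i _ fix_] <-]|_ [_ [i _ <-] [x fix_ <-]]].
  by exists (im i); [exists i | exists x].
by exists x => //; exists i.
Qed.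

HB.instance Definition _ := Choice.copy (space tau) (set_type K).
HB.instance Definition _ :=
  isOpenTopological.Build (space tau) space_openT space_openI space_open_bigU.

End SpaceTopology.

Section Join.
Context (T : Type) (K : set T) (alpha beta : topology K).

Let joinP : is_topology K (smallest (is_topology K) (alpha `|` beta)).
Proof.
have subsetsP : is_topology K [set V | V `<=` K].
  split=> [V //|//|x []|C Csub|V W VK _ x [/VK]//].
  exact: bigcup_sub.
split.
- move=> U sU; apply: (sU [set V | V `<=` K]); split=> // V [oV|oV].
    exact: (topo_sub (opensP alpha) oV).
  exact: (topo_sub (opensP beta) oV).
- by move=> M [MP _]; exact: (topo_full MP).
- by move=> M [MP _]; exact: (topo_empty MP).
- by move=> C Csub M [MP sM]; apply: (topo_bigcup MP) => U /Csub sU;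
  exact: sU.
- by move=> U V sU sV M [MP sM]; apply: (topo_setI MP);
  [exact: sU|exact: sV].
Qed.

Definition join_topology : topology K := Topology joinP.

End Join.

Definition pairwise_compact (T : choiceType) (K : set T)
    (alpha beta : topology K) (B : set (set_type K)) : Prop :=
  compact (B : set (space (join_topology alpha beta))).

Notation soft_set A G := (A -> set G).

Definition soft_subset (A G : Type) (H F : soft_set A G) : Prop :=
  forall t, H t `<=` F t.

Record is_soft_topology (A G : Type) (F : soft_set A G)
    (tau : set (soft_set A G)) : Prop := {
  soft_topo_sub : forall H, tau H -> soft_subset H F;
  soft_topo_full : tau F;
  soft_topo_empty : tau (fun=> set0);
  soft_topo_bigcup : forall C : set (soft_set A G),
    C `<=` tau -> tau (fun t => \bigcup_(H in C) H t);
  soft_topo_setI : forall H1 H2, tau H1 -> tau H2 ->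
    tau (fun t => H1 t `&` H2 t)
}.

Record soft_topology (A G : Type) (F : soft_set A G) := SoftTopology {
  soft_opens :> set (soft_set A G);
  soft_opensP : is_soft_topology F soft_opens
}.

Section Component.
Context (A G : Type) (F : soft_set A G) (tau : soft_topology F) (t : A).

Let componentP : is_topology (F t) [set H t | H in soft_opens tau].
Proof.
have tauP := soft_opensP tau; split.
- by move=> _ [H tauH <-]; apply: (soft_topo_sub tauP tauH).
- by exists F => //; exact: (soft_topo_full tauP).
- by exists (fun=> set0) => //; exact: (soft_topo_empty tauP).
- move=> C Csub; pose D := [set H | soft_opens tau H /\ C (H t)].
  exists (fun s => \bigcup_(H in D) H s).
    by apply: (soft_topo_bigcup tauP) => H [].
  apply/seteqP; split=> [x [H [_ CH] Hx]|x [U CU Ux]]; first by exists (H t).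
  by have [H tauH HU] := Csub _ CU; exists H; rewrite /D /= HU.
- move=> _ _ [H1 tauH1 <-] [H2 tauH2 <-]; exists (fun s => H1 s `&` H2 s) => //.
  exact: (soft_topo_setI tauP tauH1 tauH2).
Qed.

Definition component : topology (F t) := Topology componentP.

End Component.

Definition canonical_soft_topology (A G : Type) (F : soft_set A G)
    (tau : soft_topology F) : Prop :=
  forall H : soft_set A G,
    soft_opens tau H <-> soft_subset H F /\ forall t, opens (component tau t) (H t).

Definition soft_prod (A G : Type) (U : soft_set A G) : set (A -> G) :=
  [set f | forall t, U t (f t)].

Definition SE (A G : Type) (F : soft_set A G) : set (A -> G) := soft_prod F.

Section Selector.
Context (A G : Type) (F : soft_set A G) (tau : soft_topology F).

Definition box_base : set (set (A -> G)) :=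
  [set soft_prod U | U in [set U | forall t, opens (component tau t) (U t)]].

Let selectorP : is_topology (SE F)
  [set \bigcup_(B in C) B | C in [set C | C `<=` box_base]].
Proof.
have cP t := opensP (component tau t).
split.
- move=> _ [C CB <-] f [B /CB [U UP <-] Uf] t.
  exact: (topo_sub (cP t) (UP t)).
- exists [set SE F]; last by rewrite bigcup_set1.
  by move=> _ ->; exists F => // t; exact: (topo_full (cP t)).
- by exists set0; [exact: sub0set | rewrite bigcup_set0].
- move=> D Dsub.
  exists [set B | box_base B /\ exists2 W, D W & B `<=` W]; first by move=> B [].
  apply/seteqP; split=> [f [B [_ [W DW BW]] /BW Wf]|f [W DW Wf]].
    by exists W.
  have [C CB CW] := Dsub _ DW; move: Wf; rewrite -CW => -[B CB' Bf].
  exists B => //; split; first exact: CB.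
  by exists W => // g Bg; rewrite -CW; exists B.
- move=> _ _ [C CB <-] [D DB <-].
  exists [set B | box_base B /\
    B `<=` (\bigcup_(B in C) B) `&` (\bigcup_(B in D) B)]; first by move=> B [].
  apply/seteqP; split=> [f [B [_ BW] /BW]//|f [[B CB' Bf] [B' DB' B'f]]].
  have [U UP UB] := CB _ CB'; have [V VP VB] := DB _ DB'; subst B B'.
  exists (soft_prod (fun t => U t `&` V t)); last by move=> t; split.
  split; first by exists (fun t => U t `&` V t) => // t; apply: (topo_setI (cP t)).
  move=> g gUV; split; [exists (soft_prod U)|exists (soft_prod V)] => // t;
    by case: (gUV t).
Qed.

Definition selector_topology : topology (SE F) := Topology selectorP.

End Selector.

Definition pairwise_soft_compact (A : Type) (G : choiceType)
    (F : soft_set A G) (tau1 tau2 : soft_topology F) : Prop :=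
  compact [set: space (join_topology (selector_topology tau1)
                                     (selector_topology tau2))].

Record soft_group (A : Type) (G : groupType) := SoftGroup {
  sections :> soft_set A G;
  sectionsP : forall t, group_closed (mem (sections t))
}.

(* F(t) with the group structure inherited from G. *)
Definition section_group (A : Type) (G : groupType) (F : soft_group A G)
  (t : A) : Type := set_type (F t).

Section SectionGroup.
Context (A : Type) (G : groupType) (F : soft_group A G) (t : A).
HB.instance Definition _ := SubChoice.copy (section_group F t) (set_type (F t)).
HB.instance Definition _ :=
  SubChoice_isSubGroup.Build G (mem (F t)) (section_group F t) (sectionsP F t).
End SectionGroup.

Definition topological_group (A : Type) (G : groupType) (F : soft_group A G)
    (t : A) (tau : topology (F t)) : Prop :=
  continuous (fun z : space tau * space tau =>
    ((z.1 : section_group F t) * (z.2 : section_group F t))%g : space tau) /\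
  continuous (fun x : space tau =>
    ((x : section_group F t)^-1)%g : space tau).

Definition compact_hausdorff_group (A : Type) (G : groupType)
    (F : soft_group A G) (t : A) (tau : topology (F t)) : Prop :=
  [/\ topological_group tau, compact [set: space tau] &
      hausdorff_space (space tau)].

(* Main.v *)
Require Import Defs.
From mathcomp Require Import all_boot monoid.
From mathcomp Require Import boolp classical_sets functions cardinality.
From mathcomp Require Import topology.
From mathcomp Require Import fingroup perm.

Set Implicit Arguments.
Unset Strict Implicit.
Unset Printing Implicit Defensive.

Local Open Scope classical_set_scope.

(* Take the same finite group with at least two elements at every parameter and
   let both soft topologies consist of all soft subsets.  Every section is then
   a finite discrete group, whereas the box topology on [A -> G] contains all
   singletons, so it is discrete on an infinite set. *)

Lemma all_open_compact_finite (X : topologicalType) :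
  (forall U : set X, open U) -> compact [set: X] -> finite_set [set: X].
Proof.
move=> oX cX; apply: contrapT => infX.
(* The cofinite filter has no cluster point. *)
pose F : set_system X := [set B | finite_set (~` B)].
have FF : ProperFilter F.
  (* Infiniteness gives properness: an empty member of [F] would make the whole space finite. *)
  apply: Build_ProperFilter_ex => [B finB|].
    apply/set0P/eqP => B0; apply: infX.
    by move: finB; rewrite /F /= B0 setC0.
  split=> [|B C|B C BC]; rewrite /F /=.
  - by rewrite setCT.
  - by rewrite setCI finite_setU.
  - by apply: sub_finite_set; exact: subsetC.
have FT : F setT by rewrite /F /= setCT.
have [x [_ /(_ (~` [set x]) [set x])]] := cX F FF FT.
case=> [||y [] //]; first by rewrite /F /= setCK.
exact: open_nbhs_nbhs.
Qed.

Lemma all_open_hausdorff (X : topologicalType) :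
  (forall U : set X, open U) -> hausdorff_space X.
Proof.
move=> oX p q pq; have nX (x : X) : nbhs x [set x].
  exact: open_nbhs_nbhs.
by have [x [-> ->]] := pq _ _ (nX p) (nX q).
Qed.

Lemma all_open_continuous (X Y : topologicalType) (f : X -> Y) :
  (forall U : set X, open U) -> continuous f.
Proof.
by move=> oX x U /nbhs_singleton Ufx; apply: open_nbhs_nbhs.
Qed.

(** Each point is the product of two open singletons. This reduces continuity of a group
    multiplication to [all_open_continuous]. *)
Lemma all_open_prod (X Y : topologicalType) :
  (forall U : set X, open U) -> (forall V : set Y, open V) ->
  forall W : set (X * Y), open W.
Proof.
move=> oX oY W; rewrite openE => -[x y] Wxy.
exists ([set x], [set y]) => /=.
  by split; exact: open_nbhs_nbhs.
by move=> [x' y'] [/= -> ->].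
Qed.

Lemma space_all_open (T : choiceType) (K : set T) (tau : topology K) :
  (forall U, U `<=` K -> opens tau U) -> forall U : set (space tau), open U.
Proof.
move=> tauP U; apply: tauP => _ [x _ <-]; exact/set_mem/(valP x).
Qed.

Lemma join_openl (T : Type) (K : set T) (alpha beta : topology K) U :
  opens alpha U -> opens (join_topology alpha beta) U.
Proof. by move=> aU; rewrite /join_topology /= => M [_]; apply; left. Qed.

(** [A] embeds into [A -> G]: [delta a] takes the value [x] at [a] and [y] elsewhere, so it
    determines [a]. *)
Lemma infinite_fun (A : Type) (G : eqType) (x y : G) :
  x != y -> infinite_set [set: A] -> infinite_set [set: A -> G].
Proof.
move=> xy; apply: contra_not => fG.
pose delta (a b : A) := if `[< a = b >] then x else y.
rewrite -(preimage_setT delta); apply: finite_preimage fG => a b _ _.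
move=> /(congr1 (@^~ a)); rewrite /delta asboolT//; case: asboolP => [->//|_ /eqP].
by rewrite (negbTE xy).
Qed.

Definition discrete_soft_opens (A G : Type) (F : soft_set A G) :
  set (soft_set A G) := [set H | soft_subset H F].

Lemma discrete_soft_opensP (A G : Type) (F : soft_set A G) :
  is_soft_topology F (discrete_soft_opens F).
Proof.
split => [//|//|t x []|C CF|H1 H2 H1F _] t x //.
- by case=> H /CF HF; exact: HF.
- by case=> + _; exact: H1F.
Qed.

Definition discrete_soft_topology (A G : Type) (F : soft_set A G) :=
  SoftTopology (discrete_soft_opensP F).

Lemma discrete_component_opens (A G : Type) (F : soft_set A G) (t : A) U :
  U `<=` F t -> opens (component (discrete_soft_topology F) t) U.
Proof.
(* The implication cuts the section down to [U] at [t] and leaves all of [F s] elsewhere, with no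
   case split on [s = t]. *)
move=> UF; exists (fun s => [set x | F s x /\ (s = t -> U x)]).
  by move=> s x [].
by apply/seteqP; split=> [x [_]|x Ux]; [exact|split => //; exact: UF].
Qed.

Lemma discrete_soft_topology_canonical (A G : Type) (F : soft_set A G) :
  canonical_soft_topology (discrete_soft_topology F).
Proof.
move=> H; split=> [HF|[]//]; split=> // t.
exact: discrete_component_opens.
Qed.

(** The singleton of [f] is the box of the singletons of its values [f t]. A box may restrict all
    coordinates at once, even infinitely many, so singletons are basic open and every [U] is a union
    of them. *)
Lemma discrete_selector_opens (A G : Type) (F : soft_set A G) U :
  U `<=` SE F -> opens (selector_topology (discrete_soft_topology F)) U.
Proof.
move=> UF; exists [set [set f] | f in U]; last first.
  apply/seteqP; split=> [_ [_ [f Uf <-] ->]//|f Uf].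
  by exists [set f] => //; exists f.
move=> _ [f Uf <-]; exists (fun t => [set f t]).
  by move=> t; apply: discrete_component_opens => _ ->; exact: UF.
by apply/seteqP; split=> [g gf|_ -> //]; apply/funext.
Qed.

Lemma group_closed_setT (G : groupType) : group_closed (mem [set: G]).
Proof. by split=> [|x y _ _]; exact/mem_set. Qed.

Definition constant_soft_group (A : Type) (G : groupType) : soft_group A G :=
  SoftGroup (fun _ : A => @group_closed_setT G).

(** Compactness concerns the type of points of [K], finiteness the subset itself; the injection
    [val] transfers finiteness both ways. *)
Lemma finite_set_type (T : Type) (K : set T) :
  finite_set [set: set_type K] <-> finite_set K.
Proof.
split=> finK.
  apply: (sub_finite_set _ (finite_image (val : set_type K -> T) finK)) => x Kx.
  by exists (SigSub (mem_set Kx)).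
pose f : set_type K -> T := val.
apply: (sub_finite_set _ (finite_preimage (f := f) _ finK)).
  by move=> x _; exact/set_mem/(valP x).
by move=> x y _ _; exact: val_inj.
Qed.

Lemma finite_discrete_group (A : Type) (G : groupType) (F : soft_group A G)
    (t : A) (tau : topology (F t)) :
  finite_set (F t) -> (forall U, U `<=` F t -> opens tau U) ->
  compact_hausdorff_group tau.
Proof.
move=> finF tauP; have oF := space_all_open tauP.
split; [split| |exact: all_open_hausdorff].
- by apply: all_open_continuous; exact: all_open_prod.
- exact: all_open_continuous.
- exact/finite_compact/finite_set_type.
Qed.

Theorem proposition6p4 (A : Type) (A_infinite : infinite_set [set: A]) :
  exists (G : groupType) (F : soft_group A G) (tau1 tau2 : soft_topology F),
    [/\ canonical_soft_topology tau1,
        canonical_soft_topology tau2,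
        forall t : A,
          [/\ compact_hausdorff_group (component tau1 t),
              compact_hausdorff_group (component tau2 t) &
              pairwise_compact (component tau1 t) (component tau2 t) setT] &
        ~ pairwise_soft_compact tau1 tau2].
Proof.
(* The permutations of [bool] form a group of order two. *)
pose G : finGroupType := {perm bool}; pose F := constant_soft_group A G.
pose tau := discrete_soft_topology F.
have finF t : finite_set (F t) by exact: (@finite_finset G).
exists G, F, tau, tau; split.
- exact: discrete_soft_topology_canonical.
- exact: discrete_soft_topology_canonical.
- move=> t; have cF : compact_hausdorff_group (component tau t).
    by apply: finite_discrete_group => // U; exact: discrete_component_opens.
  (* A finite set is compact in every topology, so the join need not be computed. *)
  by split=> //; exact/finite_compact/finite_set_type.
(* The join contains the first selector topology, which is already discrete, so compactness would
   force [SE F] to be finite. *)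
- move=> cSE; have : finite_set (SE F).
    apply/finite_set_type/(all_open_compact_finite _ cSE).
    apply: space_all_open => U UF.
    by apply: join_openl; exact: discrete_selector_opens.
  rewrite (_ : SE F = setT); last by apply/seteqP; split=> // f _ t.
  apply: (@infinite_fun A G (tperm true false) 1%g) A_infinite.
  apply/eqP => /permP/(_ true).
  by rewrite perm1 tpermL.
Qed.
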